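(* Let $(\beta,\mathcal{A})$ be a numeration system such that $\beta$ is an algebraic number, $\mathcal{A}\subset\mathbb{Z}[\beta]$ and $\{0\}\subsetneq\mathcal{A}$. Let $\beta'$ be a conjugate of $\beta$ such that $|\beta'|\neq 1$, and let $\sigma:\mathbb{Q}(\beta)\to\mathbb{Q}(\beta')$ be the corresponding field isomorphism (the one with $\sigma(\beta)=\beta'$). If there is a $p$-local parallel addition function $\varphi$ in $(\beta,\mathcal{A})$, then there exists a $p$-local parallel addition function $\varphi'$ in $(\beta',\mathcal{A}')$, where $\mathcal{A}'=\{\sigma(a) : a\in\mathcal{A}\}$.
   Context: $\mathbb{N}$ contains $0$. $\mathbb{Z}[\beta]$ is the smallest ring containing $\mathbb{Z}$ and $\beta$. The conjugates of an algebraic number are all complex roots of its minimal polynomial over $\mathbb{Q}$. A numeration system is a pair $(\beta,\mathcal{A})$ where $\beta\in\mathbb{C}$, $|\beta|>1$ (the base), and $\mathcal{A}\subset\mathbb{C}$ is a finite set containing $0$ (the alphabet). For the pair $(\beta',\mathcal{A}')$ the requirement $|\beta'|>1$ on the base is dropped; the definitions below are applied to it verbatim with $\beta'$ in place of $\beta$. For alphabets $\mathcal{A},\mathcal{B}$, a function $\varphi:\mathcal{B}^{\mathbb{Z}}\to\mathcal{A}^{\mathbb{Z}}$ is $p$-local if there exist $r,t\in\mathbb{N}$ with $p=r+t+1$ and a function $\phi:\mathcal{B}^p\to\mathcal{A}$ such that for every $w=(w_j)_{j\in\mathbb{Z}}\in\mathcal{B}^{\mathbb{Z}}$ its image $z=\varphi(w)=(z_j)_{j\in\mathbb{Z}}$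 satisfies $z_j=\phi(w_{j+t},\dots,w_{j-r})$ for all $j\in\mathbb{Z}$. A digit set conversion in base $\beta$ from $\mathcal{B}$ to $\mathcal{A}$ (alphabets containing $0$) is a function $\varphi:\mathcal{B}^{\mathbb{Z}}\to\mathcal{A}^{\mathbb{Z}}$ such that for every $w=(w_j)_{j\in\mathbb{Z}}\in\mathcal{B}^{\mathbb{Z}}$ with finitely many non-zero digits, $z=\varphi(w)$ has only finitely many non-zero digits and $\sum_{j\in\mathbb{Z}}w_j\beta^j=\sum_{j\in\mathbb{Z}}z_j\beta^j$. A $p$-local parallel addition function in $(\beta,\mathcal{A})$ is a digit set conversion in base $\beta$ from $\mathcal{A}+\mathcal{A}=\{a+a' : a,a'\in\mathcal{A}\}$ to $\mathcal{A}$ that is $p$-local. *)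

(* Defs.v *)
From HB Require Import structures.
From mathcomp Require Import all_boot all_order all_algebra finmap.
From mathcomp Require Import boolp classical_sets functions cardinality fsbigop reals.
From mathcomp Require Import complex.

Set Implicit Arguments.
Unset Strict Implicit.
Unset Printing Implicit Defensive.

Import Order.TTheory GRing.Theory Num.Theory.

Local Open Scope classical_set_scope.
Local Open Scope complex_scope.
Local Open Scope ring_scope.

Section NumberFields.
Context {R : realType}.
Local Notation C := R[i].

Definition Zadjoin (beta : C) : set C :=
  smallest [set S : set C | subring_closed (mem S)]
    (range (intr : int -> C) `|` [set beta]).

(* In a field, [divring_closed] says "subfield". *)
Definition Qadjoin (beta : C) : set C :=
  smallest [set S : set C | divring_closed (mem S)]
    (range (ratr : rat -> C) `|` [set beta]).

Definition minimal_polynomial (beta : C) (P : {poly rat}) : Prop :=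
  [/\ P \is monic, root (map_poly ratr P) beta &
      forall Q : {poly rat}, Q != 0 -> root (map_poly ratr Q) beta ->
        (size P <= size Q)%N].

Definition conjugate_of (beta beta' : C) : Prop :=
  exists2 P : {poly rat}, minimal_polynomial beta P
                        & root (map_poly ratr P) beta'.

(* A map K -> L is represented by a total function whose values outside K are
   unconstrained. *)
Definition field_isomorphism (K L : set C) (sigma : C -> C) : Prop :=
  [/\ set_bij K L sigma,
      sigma 1 = 1,
      forall x y, K x -> K y -> sigma (x + y) = sigma x + sigma y &
      forall x y, K x -> K y -> sigma (x * y) = sigma x * sigma y].

End NumberFields.

(* The window (w_{j+t}, ..., w_{j-r}) is listed by decreasing index. *)
Definition p_local (p : nat) (B A : Type) (phi : (int -> B) -> (int -> A)) :
    Prop :=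
  exists r t : nat, p = (r + t + 1)%N /\
  exists Phi : p.-tuple B -> A, forall (w : int -> B) (j : int),
    phi w j = Phi [tuple w (j + t%:Z - (i : nat)%:Z) | i < p].

Section Numeration.
Context {R : realType}.
Local Notation C := R[i].

Definition numeration_system (beta : C) (A : {fset C}) : Prop :=
  1 < `|beta| /\ 0 \in A.

Definition finitely_supported (A : {fset C}) (w : int -> A) : Prop :=
  finite_set [set j | val (w j) != 0].

(* The finitely supported sum [\sum_(_ \in _)] is by convention 0 when the
   support is infinite; [evaluation] is only used for [finitely_supported] words. *)
Definition evaluation (beta : C) (A : {fset C}) (w : int -> A) : C :=
  \sum_(j \in [set: int]) (val (w j) * beta ^ j).

Definition digit_set_conversion (beta : C) (B A : {fset C})
    (phi : (int -> B) -> (int -> A)) : Prop :=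
  [/\ 0 \in B, 0 \in A &
      forall w : int -> B, finitely_supported w ->
        finitely_supported (phi w) /\ evaluation beta w = evaluation beta (phi w)].

Definition sumset (A B : {fset C}) : {fset C} :=
  [fset (a + b)%R | a in A, b in B]%fset.

Definition parallel_addition (p : nat) (beta : C) (A : {fset C})
    (phi : (int -> sumset A A) -> (int -> A)) : Prop :=
  digit_set_conversion beta phi /\ p_local p phi.

End Numeration.

(* Main.v *)
Require Import Defs.
From mathcomp Require Import all_boot all_order all_algebra finmap.
From mathcomp Require Import boolp classical_sets functions cardinality fsbigop reals.
From mathcomp Require Import complex.

(** The parallel addition function is transported along [sigma], digit by
    digit: a word over [A' + A'] is pulled back to a word over [A + A] by
    choosing a preimage of each digit, [phi] is applied, and the digits of the
    result are pushed forward by [sigma].  The window is the same, so [p] is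
    too ([p_local_transport]).

    The value of a finitely supported word is a Laurent polynomial expression
    in the base with coefficients in Q(beta), hence [sigma] maps the value of a
    word in base [beta] to the value of its image in base [sigma beta]
    ([sigma_evaluation]); a field morphism kills no nonzero digit, hence finite
    support is kept in both directions ([finitely_supported_sigma]).  Equality
    of values before and after [phi] is thus carried over
    ([digit_set_conversion_transport]).  Only finite sums are evaluated, so the
    argument is purely algebraic. *)

Import Order.TTheory GRing.Theory Num.Theory.

Local Open Scope classical_set_scope.
Local Open Scope complex_scope.
Local Open Scope ring_scope.

(** * Subfields of C generated by a number *)

(** Subfields are stable under intersection, so the smallest one is a subfield. *)
Lemma smallest_divring_closed (F : unitRingType) (G : set F) :
  divring_closed (mem (smallest [set S : set F | divring_closed (mem S)] G)).
Proof.
split=> [|x y|x y].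
- by apply/mem_set => S [[+ _ _] _]; apply: set_mem.
- move=> /set_mem Kx /set_mem Ky; apply/mem_set => S [SF GS].
  have [_ SB _] : divring_closed (mem S) := SF.
  by apply/set_mem/SB; apply/mem_set; [apply: Kx|apply: Ky].
- move=> /set_mem Kx /set_mem Ky; apply/mem_set => S [SF GS].
  have [_ _ SV] : divring_closed (mem S) := SF.
  by apply/set_mem/SV; apply/mem_set; [apply: Kx|apply: Ky].
Qed.

Lemma beta_in_Qadjoin (R : realType) (beta : R[i]) : Qadjoin beta beta.
Proof. by apply: sub_gen_smallest; right. Qed.

Lemma Zadjoin_sub_Qadjoin (R : realType) (beta : R[i]) :
  Zadjoin beta `<=` Qadjoin beta.
Proof.
apply: smallest_sub.
  exact: GRing.divring_closedBM (smallest_divring_closed _ _).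
move=> x [[n _ <-]|->]; apply: sub_gen_smallest; last by right.
by left; exists n%:~R => //; rewrite ratr_int.
Qed.

(** * Morphisms out of a subfield *)

(** As [sigma] is unconstrained outside the subfield [K], it is no ring morphism
    on the ambient field; the usual morphism laws are derived for arguments
    in [K]. *)

Section SubfieldMorphism.
Context {F F' : fieldType} {K : set F} {sigma : F -> F'}.
Context (K_divring : divring_closed (mem K)) (sigma1 : sigma 1 = 1).
Context (sigmaD : forall x y, K x -> K y -> sigma (x + y) = sigma x + sigma y).
Context (sigmaM : forall x y, K x -> K y -> sigma (x * y) = sigma x * sigma y).

Lemma subfield1 : K 1.
Proof. by have [K1 _ _] := K_divring; apply: set_mem. Qed.

Lemma subfieldB x y : K x -> K y -> K (x - y).
Proof.
by have [_ KB _] := K_divring => Kx Ky; apply/set_mem/KB; apply/mem_set.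
Qed.

Lemma subfield0 : K 0.
Proof. by rewrite -(subrr 1); apply: subfieldB; apply: subfield1. Qed.

Lemma subfieldD x y : K x -> K y -> K (x + y).
Proof.
move=> Kx Ky; rewrite -[y]opprK -[- y]add0r.
by do 2![apply: subfieldB => //]; apply: subfield0.
Qed.

Lemma subfieldV x : K x -> K x^-1.
Proof.
have [_ _ KV] := K_divring => Kx; rewrite -[x^-1]mul1r; apply/set_mem/KV.
  exact/mem_set/subfield1.
exact/mem_set.
Qed.

Lemma subfieldM x y : K x -> K y -> K (x * y).
Proof.
have [_ _ KV] := K_divring => Kx Ky; rewrite -[y]invrK.
by apply/set_mem/KV; apply/mem_set => //; apply: subfieldV.
Qed.

Lemma subfieldX x n : K x -> K (x ^+ n).
Proof.
by move=> Kx; elim: n => [|n IHn]; rewrite ?exprS; [apply: subfield1|apply: subfieldM].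
Qed.

Lemma subfieldXz x (z : int) : K x -> K (x ^ z).
Proof.
move=> Kx; case: z => n; first exact: subfieldX.
by rewrite NegzE -exprnN; apply/subfieldV/subfieldX.
Qed.

Lemma sigma0 : sigma 0 = 0.
Proof.
by apply: (addrI (sigma 0)); rewrite -sigmaD ?addr0 //; apply: subfield0.
Qed.

(** Injectivity comes for free: if [x] is nonzero then [sigma x] divides
    [sigma 1 = 1]. *)
Lemma sigma_eq0 x : K x -> (sigma x == 0) = (x == 0).
Proof.
move=> Kx; apply/eqP/eqP => [sx0|->]; last exact: sigma0.
apply: contra_eq (oner_neq0 F') => x0.
by rewrite -sigma1 -(divff x0) sigmaM ?sx0 ?mul0r ?eqxx //; apply: subfieldV.
Qed.

Lemma sigmaV x : K x -> sigma x^-1 = (sigma x)^-1.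
Proof.
move=> Kx; have [->|x0] := eqVneq x 0; first by rewrite invr0 sigma0 invr0.
have sx0 : sigma x != 0 by rewrite sigma_eq0.
by apply: (mulfI sx0); rewrite -sigmaM ?divff ?sigma1 //; apply: subfieldV.
Qed.

Lemma sigmaX x n : K x -> sigma (x ^+ n) = sigma x ^+ n.
Proof.
move=> Kx; elim: n => [|n IHn]; first by rewrite !expr0.
by rewrite !exprS sigmaM ?IHn //; apply: subfieldX.
Qed.

Lemma sigmaXz x (z : int) : K x -> sigma (x ^ z) = sigma x ^ z.
Proof.
move=> Kx; case: z => n; first exact: sigmaX.
by rewrite NegzE -!exprnN sigmaV ?sigmaX //; apply: subfieldX.
Qed.

(** Membership of the partial sums in [K] is carried through the induction,
    since additivity of [sigma] is only available there. *)
Lemma sigma_sum (I : Type) (s : seq I) (f : I -> F) :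
  (forall i, K (f i)) -> sigma (\sum_(i <- s) f i) = \sum_(i <- s) sigma (f i).
Proof.
move=> Kf.
suff [] : K (\sum_(i <- s) f i) /\
    sigma (\sum_(i <- s) f i) = \sum_(i <- s) sigma (f i) by [].
elim: s => [|i s [Ks IHs]].
  by rewrite !big_nil sigma0; split=> //; apply: subfield0.
by rewrite !big_cons sigmaD // IHs; split=> //; apply: subfieldD.
Qed.

End SubfieldMorphism.

(** * Transport of digit set conversions *)

Lemma p_local_transport (p : nat) (A A' B B' : Type) (pull : B' -> B)
    (push : A -> A') (phi : (int -> B) -> (int -> A)) :
  p_local p phi -> p_local p (fun w j => push (phi (pull \o w) j)).
Proof.
move=> [r [t [-> [Phi phiE]]]]; exists r, t; split=> //.
exists (fun u => push (Phi (map_tuple pull u))) => w j; rewrite phiE.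
by congr (push (Phi _)); apply: eq_from_tnth => i; rewrite !(tnth_map, tnth_mktuple).
Qed.

Section Transport.
Context {R : realType} {K : set R[i]} {sigma : R[i] -> R[i]} {beta : R[i]}.
Context (K_divring : divring_closed (mem K)) (sigma1 : sigma 1 = 1).
Context (sigmaD : forall x y, K x -> K y -> sigma (x + y) = sigma x + sigma y).
Context (sigmaM : forall x y, K x -> K y -> sigma (x * y) = sigma x * sigma y).
Context (K_beta : K beta).

Lemma finitely_supported_sigma {A A' : {fset R[i]}} {w : int -> A}
    {w' : int -> A'} :
  (forall a, a \in A -> K a) -> (forall j, val (w' j) = sigma (val (w j))) ->
  finitely_supported w' <-> finitely_supported w.
Proof.
move=> KA w'E; rewrite /finitely_supported.
suff -> : [set j | val (w' j) != 0] = [set j | val (w j) != 0] by [].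
apply/seteqP; split=> j /=;
  by rewrite w'E (sigma_eq0 K_divring sigma1 sigmaD sigmaM) //; apply/KA/valP.
Qed.

Lemma evaluation_finite (b : R[i]) (A : {fset R[i]}) (w : int -> A)
    (S : {fset int}) :
  (forall j, j \notin S -> val (w j) = 0) ->
  evaluation b w = \sum_(j <- S) val (w j) * b ^ j.
Proof.
by move=> w0; apply: (fsbigTE S) => j jS; rewrite w0 ?mul0r.
Qed.

(** Both words vanish outside one finite set of positions, so both values are
    the same finite sum up to [sigma]. *)
Lemma sigma_evaluation {A A' : {fset R[i]}} {w : int -> A} {w' : int -> A'} :
  (forall a, a \in A -> K a) -> (forall j, val (w' j) = sigma (val (w j))) ->
  finitely_supported w ->
  sigma (evaluation beta w) = evaluation (sigma beta) w'.
Proof.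
move=> KA w'E /finite_fsetP[S wS].
have w0 j : j \notin S -> val (w j) = 0.
  move=> jS; apply/eqP/negPn; apply: contra jS => wj.
  by have : [set` S] j by rewrite -wS.
have Kw j : K (val (w j)) by apply/KA/valP.
have KX j : K (beta ^ j) by apply: (subfieldXz K_divring).
rewrite (evaluation_finite _ _ _ S w0) (evaluation_finite _ _ w' S); last first.
  by move=> j /w0 wj; rewrite w'E wj (sigma0 K_divring sigmaD).
rewrite (sigma_sum K_divring sigmaD) => [|j]; last exact: (subfieldM K_divring).
apply: eq_bigr => j _.
by rewrite sigmaM // (sigmaXz K_divring sigma1 sigmaD sigmaM) // w'E.
Qed.

(** Here [pull] may be any section of [sigma] on the digits: the two digit words
    determine each other's support and value through [sigma], whichever
    preimages are chosen. *)
Lemma digit_set_conversion_transport (A A' B B' : {fset R[i]})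
    (pull : B' -> B) (push : A -> A') (phi : (int -> B) -> (int -> A)) :
  (forall a, a \in A -> K a) -> (forall b, b \in B -> K b) ->
  (forall b', sigma (val (pull b')) = val b') ->
  (forall a, val (push a) = sigma (val a)) ->
  0 \in A' -> 0 \in B' ->
  digit_set_conversion beta phi ->
  digit_set_conversion (sigma beta) (fun w j => push (phi (pull \o w) j)).
Proof.
move=> KA KB pullE pushE A'0 B'0 [_ _ phiP]; split=> // w' w'fin.
pose w := pull \o w'.
have w'E j : val (w' j) = sigma (val (w j)) by rewrite /w /= pullE.
have zE j : val (push (phi w j)) = sigma (val (phi w j)) by exact: pushE.
have wfin : finitely_supported w by apply/(finitely_supported_sigma KB w'E).
have [zfin evE] := phiP w wfin.
split; first exact/(finitely_supported_sigma KA zE).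
by rewrite -(sigma_evaluation KB w'E wfin) evE (sigma_evaluation KA zE zfin).
Qed.

End Transport.

Theorem lemma3p2 (R : realType) (beta : R[i]) (A : {fset R[i]})
  (beta' : R[i]) (sigma : R[i] -> R[i]) (p : nat)
  (numsys : numeration_system beta A)
  (beta_alg : algebraicOver (ratr : rat -> R[i]) beta)
  (A_Zbeta : forall a, a \in A -> Zadjoin beta a)
  (A_nontriv : ([fset 0] `<` A)%fset)
  (beta'_conj : conjugate_of beta beta')
  (beta'_norm : `|beta'| != 1)
  (sigma_iso : field_isomorphism (Qadjoin beta) (Qadjoin beta') sigma)
  (sigma_beta : sigma beta = beta') :
  (exists phi : (int -> sumset A A) -> (int -> A),
     parallel_addition p beta phi) ->
  let A' := [fset sigma a | a in A]%fset in
  exists phi' : (int -> sumset A' A') -> (int -> A'),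
     parallel_addition p beta' phi'.
Proof.
move=> [phi [phi_conv phi_local]] A'.
have K_divring : divring_closed (mem (Qadjoin beta)).
  exact: smallest_divring_closed.
have [_ sigma1 sigmaD sigmaM] := sigma_iso.
have KA a : a \in A -> Qadjoin beta a by move=> /A_Zbeta /Zadjoin_sub_Qadjoin.
have KB b : b \in sumset A A -> Qadjoin beta b.
  by move=> /imfset2P[a aA [c cA ->]]; apply: (subfieldD K_divring); apply: KA.
have A'0 : 0 \in A'.
  have [_ A0] := numsys; apply/imfsetP; exists 0 => //=.
  by rewrite (sigma0 K_divring sigmaD).
have B'0 : 0 \in sumset A' A'.
  by apply/imfset2P; exists 0 => //; exists 0 => //; rewrite addr0.
have push_ex (a : A) : exists a' : A', val a' = sigma (val a).
  have sA' : sigma (val a) \in A' by apply/imfsetP; exists (val a) => //; apply: valP.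
  by exists [` sA']%fset.
have pull_ex (b' : sumset A' A') :
    exists b : sumset A A, sigma (val b) = val b'.
  have /imfset2P[_ /imfsetP[a aA ->] [_ /imfsetP[c cA ->] ->]] := valP b'.
  have acB : a + c \in sumset A A by apply/imfset2P; exists a => //; exists c.
  by exists [` acB]%fset; rewrite /= sigmaD //; apply: KA.
have [push pushE] := choice push_ex.
have [pull pullE] := choice pull_ex.
exists (fun w j => push (phi (pull \o w) j)); split.
  rewrite -sigma_beta.
  exact: (digit_set_conversion_transport K_divring sigma1 sigmaD sigmaM
            (beta_in_Qadjoin _ beta) A A' _ _ pull push phi KA KB).
exact: (p_local_transport _ _ _ _ _ pull push phi phi_local).
Qed.
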